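(* A ring $R$ is a UU ring if and only if every unit of $R$ is uniquely nil-clean.
   Context: Rings are associative with identity, not necessarily commutative. $U(R)$ is the group of units of $R$ and ${\rm Nil}(R)$ is the set of nilpotent elements of $R$. $R$ is a UU ring if $U(R)=1+{\rm Nil}(R)$. An element $a\in R$ is uniquely nil-clean if there exists a unique idempotent $e\in R$ such that $a-e$ is nilpotent. *)

(* Defs.v *)
From mathcomp Require Import all_boot all_order all_algebra.

Set Implicit Arguments.
Unset Strict Implicit.
Unset Printing Implicit Defensive.

Import GRing.Theory.
Local Open Scope ring_scope.

(* Rings are taken in pzRingType: associative with identity, neither
   commutativity nor 1 != 0 being assumed.  GRing.unit is not available at this
   level (unitRingType additionally requires decidable invertibility and
   1 != 0), so units are defined as the two-sided invertible elements. *)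
Definition is_unit (R : pzRingType) (u : R) : Prop :=
  exists v : R, u * v = 1 /\ v * u = 1.

(* The exponent 0 gives nothing new: x ^+ 0 = 1 vanishes only in the zero
   ring. *)
Definition is_nilpotent (R : pzRingType) (x : R) : Prop :=
  exists n : nat, x ^+ n = 0.

Definition is_idempotent (R : pzRingType) (e : R) : Prop := e * e = e.

Definition UU_ring (R : pzRingType) : Prop :=
  forall u : R, is_unit u <-> exists x : R, is_nilpotent x /\ u = 1 + x.

Definition uniquely_nil_clean (R : pzRingType) (a : R) : Prop :=
  exists! e : R, is_idempotent e /\ is_nilpotent (a - e).

(* Main.v *)
(** In a UU ring, square-zero elements [a], [b] have nilpotent product: with
    [N = a + b + ab] and [t = ab + ba], the element [1 + N = (1 + a)(1 + b)]
    is a unit, so [N] is nilpotent, while [N^2 = t (1 + N)] and [t] commutes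
    with [N]; hence [t] is nilpotent, and so is [ab].  It follows that
    [f r (1 - f)] lies in the Jacobson radical [J] for every idempotent [f], so
    idempotents are central modulo [J].  If a unit [u] equals [1 - f + n] with
    [n] nilpotent, then [f u = f n], hence [f u^k = f n^k] modulo [J] for all
    [k], so [f] lies in [J] and vanishes.

    Conversely, if [u = e + n] is the only nil-clean decomposition of the unit
    [u], conjugating it by [u] shows that [e] commutes with [u]; then
    [(1 - e) u^k = (1 - e) n^k] for all [k], which forces [e = 1]. *)
Require Import Defs.
From mathcomp Require Import all_boot all_order all_algebra.

Set Implicit Arguments.
Unset Strict Implicit.
Unset Printing Implicit Defensive.

Import GRing.Theory.
Local Open Scope ring_scope.

Section UnitsAndNilpotents.
Variable R : pzRingType.
Implicit Types a b e f n r u v x y : R.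

Lemma is_unitM u v : is_unit u -> is_unit v -> is_unit (u * v).
Proof.
move=> [u' [uu' u'u]] [v' [vv' v'v]]; exists (v' * u'); split.
  by rewrite mulrA -(mulrA u) vv' mulr1.
by rewrite mulrA -(mulrA v') u'u mulr1.
Qed.

Lemma is_unitX u k : is_unit u -> is_unit (u ^+ k).
Proof.
move=> uU; elim: k => [|k IHk]; last by rewrite exprS; apply: is_unitM.
by exists 1; rewrite mulr1.
Qed.

Lemma is_unit_rreg u x : is_unit u -> x * u = 0 -> x = 0.
Proof. by move=> [v [uv _]] xu0; rewrite -(mulr1 x) -uv mulrA xu0 mul0r. Qed.

Lemma is_nilpotentN x : is_nilpotent x -> is_nilpotent (- x).
Proof. by case=> k xk0; exists k; rewrite exprNn xk0 mulr0. Qed.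

Lemma is_unit_1B_nilpotent x : is_nilpotent x -> is_unit (1 - x).
Proof.
case=> k xk0; pose s := \sum_(i < k) x ^+ i.
have xs : (1 - x) * s = 1.
  by apply: oppr_inj; rewrite -mulNr opprB -subrX1 xk0 sub0r.
exists s; split=> //; rewrite -[RHS]xs.
suff: GRing.comm (1 - x) s by move->.
apply: commr_sum => i _; apply: commrX; apply: commr_sym.
by apply: commrB => //; apply: commr1.
Qed.

Lemma is_unit_1D_nilpotent x : is_nilpotent x -> is_unit (1 + x).
Proof. by move/is_nilpotentN/is_unit_1B_nilpotent; rewrite opprK. Qed.

(** Jacobson's lemma: if [w] inverts [1 - x * y], then [1 + y * w * x] inverts [1 - y * x]. *)
Lemma is_unit_1B_mulC x y : is_unit (1 - x * y) -> is_unit (1 - y * x).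
Proof.
case=> w [xyw wxy]; exists (1 + y * w * x); split.
  have -> : (1 - y * x) * (1 + y * w * x)
            = 1 - y * x + y * ((1 - x * y) * w) * x.
    by rewrite mulrDr mulr1 !mulrBl mulrBr mulrBl !mul1r !mulrA.
  by rewrite xyw mulr1 subrK.
have -> : (1 + y * w * x) * (1 - y * x)
          = 1 - y * x + y * (w * (1 - x * y)) * x.
  by rewrite mulrDl mul1r !mulrBr !mulr1 mulrBl !mulrA.
by rewrite wxy mulr1 subrK.
Qed.

Lemma nilpotent_conj u v n :
  v * u = 1 -> is_nilpotent n -> is_nilpotent (u * n * v).
Proof.
(* Positive exponents only: at exponent 0 the formula [H] would require [u * v = 1]. *)
move=> vu [k nk0]; exists k.+1.
have H j : (u * n * v) ^+ j.+1 = u * n ^+ j.+1 * v.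
  elim: j => [|j IHj]; first by rewrite !expr1.
  by rewrite exprS IHj [in RHS]exprS !mulrA -(mulrA _ v u) vu mulr1.
by rewrite H exprS nk0 mulr0 mulr0 mul0r.
Qed.

(** The Jacobson radical in elementwise form; it is a two-sided ideal, closure under right
    multiplication coming from [is_unit_1B_mulC]. *)
Definition in_radical x : Prop := forall r, is_unit (1 - r * x).

Lemma in_radicalMl r x : in_radical x -> in_radical (r * x).
Proof. by move=> Jx s; rewrite mulrA. Qed.

Lemma in_radicalMr x r : in_radical x -> in_radical (x * r).
Proof.
by move=> Jx s; rewrite mulrA; apply: is_unit_1B_mulC; rewrite mulrA.
Qed.

Lemma in_radicalD x y : in_radical x -> in_radical y -> in_radical (x + y).
Proof.
(* Factoring out the unit [1 - r * x], with inverse [v], leaves a unit given by [Jy] at [v * r]. *)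
move=> Jx Jy r; have [v [uv vu]] := Jx r.
have -> : 1 - r * (x + y) = (1 - r * x) * (1 - v * r * y).
  by rewrite mulrBr mulr1 !mulrA uv mul1r mulrDr opprD addrA.
exact: is_unitM.
Qed.

Lemma in_radicalN x : in_radical x -> in_radical (- x).
Proof. by move=> Jx; rewrite -mulN1r; apply: in_radicalMl. Qed.

Lemma in_radical0 : in_radical 0.
Proof. by move=> r; exists 1; rewrite mulr0 subr0 mulr1. Qed.

Lemma is_idempotentC f : is_idempotent f -> is_idempotent (1 - f).
Proof.
by move=> ff; rewrite /is_idempotent mulrBr mulr1 mulrBl mul1r ff subrr subr0.
Qed.

Lemma in_radical_idempotent f : is_idempotent f -> in_radical f -> f = 0.
Proof.
move=> ff /(_ 1); rewrite mul1r => /is_unit_rreg; apply.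
by rewrite mulrBr mulr1 ff subrr.
Qed.

Lemma UU_square0_mul_nilpotent a b :
  UU_ring R -> a * a = 0 -> b * b = 0 -> is_nilpotent (a * b).
Proof.
move=> UU aa bb; pose t := a * b + b * a; pose N := a + b + a * b.
have sq0_unit x : x * x = 0 -> is_unit (1 + x).
  by move=> xx; apply: is_unit_1D_nilpotent; exists 2; rewrite expr2.
have NE : (1 + a) * (1 + b) = 1 + N.
  by rewrite mulrDl mul1r mulrDr mulr1 /N -!addrA [b + _]addrCA.
have N_unit : is_unit (1 + N) by rewrite -NE; apply: is_unitM; apply: sq0_unit.
have [k Nk0] : is_nilpotent N.
  by have [/(_ N_unit) [x [xnil /addrI ->]] _] := UU (1 + N).
have at_ : a * t = a * b * a by rewrite mulrDr !mulrA aa mul0r add0r.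
have ta : t * a = a * b * a by rewrite mulrDl -!mulrA aa mulr0 addr0.
have bt : b * t = b * a * b by rewrite mulrDr !mulrA bb mul0r addr0.
have tb : t * b = b * a * b by rewrite mulrDl -!mulrA bb mulr0 add0r.
have ct_a : GRing.comm t a by rewrite /GRing.comm ta at_.
have ct_b : GRing.comm t b by rewrite /GRing.comm tb bt.
have ct_N : GRing.comm t N by apply/commrD/commrM => //; apply: commrD.
have NN : N * N = t * (1 + N).
  rewrite [RHS]mulrDr mulr1 /N [in RHS]mulrDr [in RHS]mulrDr ta tb.
  rewrite [t * (_ * _)]mulrA ta.
  rewrite !mulrDl !mulrDr !mulrA aa bb -(mulrA a b b) bb.
  rewrite !(mul0r, mulr0, addr0, add0r) /t -!addrA.
  by rewrite [b * a * b + _]addrCA.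
have tk0 : t ^+ k = 0.
  (* Since [t] commutes with [1 + N], the product [t ^+ k * (1 + N) ^+ k] is [(N * N) ^+ k = 0]. *)
  apply: (is_unit_rreg (is_unitX k N_unit)).
  rewrite -exprMn_comm -?NN; last by apply: commrD => //; apply: commr1.
  by rewrite exprMn_comm // Nk0 mul0r.
(* The other term [a * b * b * a] vanishes; by induction [(a * b) ^+ k.+1 = a * b * t ^+ k]. *)
have abt : a * b * t = a * b * (a * b).
  by rewrite /t mulrDr !mulrA -(mulrA a b b) bb mulr0 mul0r addr0.
exists k.+1; rewrite -(mulr0 (a * b)) -tk0.
elim: {Nk0 tk0} k => [|k IHk]; first by rewrite expr0 mulr1.
by rewrite exprS IHk [t ^+ _.+1]exprS !mulrA abt !mulrA.
Qed.

Lemma UU_peirce_in_radical f r :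
  UU_ring R -> is_idempotent f -> in_radical (f * r * (1 - f)).
Proof.
move=> UU ff s.
have gf : (1 - f) * f = 0 by rewrite mulrBl mul1r ff subrr.
have fg : f * (1 - f) = 0 by rewrite mulrBr mulr1 ff subrr.
have gg := is_idempotentC ff.
pose b := f * r * (1 - f); pose c := (1 - f) * s * f.
(* As [1 - x y] and [1 - y x] are simultaneously invertible, [f] and [1 - f]
   can be moved around cyclically, turning [s b] into the product [c b] of two
   square-zero elements. *)
suff cb_unit : is_unit (1 - c * b).
  have -> : s * (f * r * (1 - f)) = (s * b) * (1 - f).
    by rewrite /b -!mulrA gg.
  apply: is_unit_1B_mulC.
  have <- : c * b = (1 - f) * (s * b) by rewrite /c /b !mulrA -(mulrA _ f f) ff.
  exact: cb_unit.
apply/is_unit_1B_nilpotent/UU_square0_mul_nilpotent => //.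
  by rewrite /c !mulrA -(mulrA _ f (1 - f)) fg mulr0 !mul0r.
by rewrite /b !mulrA -(mulrA _ (1 - f) f) gf mulr0 !mul0r.
Qed.

(** The commutator is the difference of the two off-diagonal Peirce components of [r], both in the
    radical. *)
Lemma UU_idempotent_central_mod_radical f r :
  UU_ring R -> is_idempotent f -> in_radical (f * r - r * f).
Proof.
move=> UU ff.
have -> : f * r - r * f = f * r * (1 - f) - (1 - f) * r * (1 - (1 - f)).
  by rewrite subKr mulrBr mulr1 mulrBl mulrBl mul1r opprB addrA subrK.
apply: in_radicalD; first exact: UU_peirce_in_radical.
by apply: in_radicalN; apply: UU_peirce_in_radical => //; apply: is_idempotentC.
Qed.

Lemma UU_idempotent_eq0 u f n :
  UU_ring R -> is_unit u -> is_idempotent f -> is_nilpotent n ->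
  f * u = f * n -> f = 0.
Proof.
move=> UU u_unit ff [k nk0] fu.
have J_fX j : in_radical (f * u ^+ j - f * n ^+ j).
  elim: j => [|j IHj]; first by rewrite subrr; apply: in_radical0.
  (* Replace [f * u] by [f * n], then move [n] to the left of [f] in both terms at the cost of
     commutators. *)
  have -> : f * u ^+ j.+1 - f * n ^+ j.+1 =
      (f * n - n * f) * u ^+ j + n * (f * u ^+ j - f * n ^+ j)
      - (f * n - n * f) * n ^+ j.
    by rewrite !exprS !mulrA fu !mulrBl mulrBr !mulrA opprB !addrA !subrK.
  have Jc := UU_idempotent_central_mod_radical n UU ff.
  apply: in_radicalD; last by apply/in_radicalN/in_radicalMr.
  by apply: in_radicalD; [apply: in_radicalMr | apply: in_radicalMl].
have [v [uv _]] := is_unitX k u_unit.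
apply: in_radical_idempotent => //.
by have := in_radicalMr v (J_fX k); rewrite nk0 mulr0 subr0 -mulrA uv mulr1.
Qed.

Lemma mulr_idempotentC u e :
  is_idempotent e -> (1 - e) * u = (1 - e) * (u - e).
Proof.
by move=> ee; rewrite mulrBr [(1 - e) * e]mulrBl mul1r ee subrr subr0.
Qed.

Lemma UU_unit_nil_clean u e :
  UU_ring R -> is_unit u -> is_idempotent e -> is_nilpotent (u - e) -> e = 1.
Proof.
move=> UU u_unit ee nil_ue; apply/esym/subr0_eq.
apply: (UU_idempotent_eq0 UU u_unit _ nil_ue); first exact: is_idempotentC.
exact: mulr_idempotentC.
Qed.

Lemma comm_unit_nil_clean u e :
  is_unit u -> is_idempotent e -> GRing.comm e u -> is_nilpotent (u - e) ->
  e = 1.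
Proof.
move=> u_unit ee eu [k nk0]; apply/esym/subr0_eq.
apply: (is_unit_rreg (is_unitX k u_unit)).
have fu := mulr_idempotentC u ee.
(* Commutation makes the comparison of powers an exact equality, so no radical is involved. *)
have cn : GRing.comm (1 - e) (u - e).
  apply/commr_sym/commrB; first exact: commr1.
  by apply/commr_sym/commrB.
rewrite -[RHS](mulr0 (1 - e)) -nk0.
elim: {nk0} k => [|k IHk]; first by rewrite !expr0.
by rewrite !exprS !mulrA fu cn -!mulrA IHk.
Qed.

End UnitsAndNilpotents.

Theorem theorem2p23 (R : pzRingType) :
  UU_ring R <-> (forall u : R, is_unit u -> uniquely_nil_clean u).
Proof.
split=> [UU u u_unit | clean u].
  exists 1; split=> [|e [ee nil_ue]]; last first.
    exact/esym/(UU_unit_nil_clean UU u_unit).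
  have [/(_ u_unit) [x [x_nil ->]] _] := UU u.
  by split; [apply: mulr1 | rewrite addrAC subrr add0r].
split=> [u_unit | [x [x_nil ->]]]; last exact: is_unit_1D_nilpotent.
have [e [[ee ue_nil] e_uniq]] := clean u u_unit.
have [v [uv vu]] := u_unit.
(* Conjugation by [u] fixes [u], so it turns [e] into another idempotent of a nil-clean
   decomposition of [u]. *)
have e_conj : e = u * e * v.
  apply: e_uniq; split.
    by rewrite /is_idempotent !mulrA -(mulrA _ v u) vu mulr1 -(mulrA u) ee.
  have -> : u - u * e * v = u * (u - e) * v.
    by rewrite mulrBr mulrBl -(mulrA u u v) uv mulr1.
  exact: nilpotent_conj.
have eu : GRing.comm e u.
  by rewrite /GRing.comm {1}e_conj -mulrA vu mulr1.
have e1 := comm_unit_nil_clean u_unit ee eu ue_nil.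
rewrite e1 in ue_nil; by exists (u - 1); rewrite [1 + _]addrC subrK.
Qed.
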